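(* Let $l\in E_1:=E_H\setminus F$ be an operational link. Suppose there exists a hyper-node $U$ with $l\in E_U$ such that: 1. $\tilde D_{U,e}\tilde D_{U,e'}>0$ for all $e,e'\in E_U\cap E_1$; 2. $S_U=\emptyset$ if $E_U\cap F\neq\emptyset$; 3. $f_{U,g}-\eta|\tilde D_{U,l}|<0$. Then $l$ is not detected (as failed) by the Failed Link Detection algorithm with threshold $\eta$, i.e. $l\notin\hat F$.
   Context: Let $G=(V,E)$ be a finite connected simple undirected graph (the power grid); each link $(s,t)\in E$ has a reactance $r_{st}=r_{ts}\neq 0$. The admittance matrix $B=(b_{uv})_{u,v\in V}$ of $G$ has $b_{uv}=-1/r_{uv}$ if $u\ne v$ and $(u,v)\in E$, $b_{uv}=0$ if $u\neq v$ and $(u,v)\notin E$, and $b_{uu}=-\sum_{w\in V\setminus\{u\}}b_{uw}$. Before the attack, the phase angles $\theta\in\mathbb R^V$ and active power injections $p\in\mathbb R^V$ satisfy $B\theta=p$. The attacked area $H=(V_H,E_H)$ is the subgraph of $G$ induced by $V_H\subseteq V$; the attack disconnects a nonempty set $F\subseteq E_H$ of links. After the attack, $\theta',p'\in\mathbb R^V$ satisfy $B'\theta'=p'$, where $B'$ is the admittance matrix of $(V,E\setminus F)$ with the same reactances. Put $\Delta^*:=p-p'$ (ground-truth change of injections). Standing assumptions: $\theta'_s\neq\theta'_t$ for every $(s,t)\in E_H$; and for every $v\in V_H$, $0\le\Delta^*_v\le p_v$ if $p_v>0$ and $p_v\le\Delta^*_v\le 0$ if $p_v\le 0$. For $u\in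 V_H$ and $e\in E_H$, let $\tilde D_{u,e}:=(\theta'_u-\theta'_v)/r_{uv}$ if $e=(u,v)$ is incident to $u$, and $\tilde D_{u,e}:=0$ otherwise. Failed Link Detection algorithm with threshold $\eta\in(0,1)$: take an optimal solution $(x,\delta)$, $x\in\mathbb R^{E_H}$, $\delta\in\mathbb R^{V_H}$, of the linear program: minimize $\sum_{e\in E_H}x_e$ subject to $\delta_v=(B(\theta-\theta'))_v+\sum_{e\in E_H}\tilde D_{v,e}x_e$ for all $v\in V_H$; $0\le\delta_v\le p_v$ for $v\in V_H$ with $p_v>0$; $p_v\le\delta_v\le0$ for $v\in V_H$ with $p_v\le0$; $0\le x_e\le1$ for all $e\in E_H$. Return $\hat F:=\{e\in E_H: x_e\ge\eta\}$. For $u\in V_H$: if $p_u\le 0$, $g_{D,u}:=-\Delta^*_u$ and $g_{D,-u}:=-p'_u$; if $p_u>0$, $g_{D,u}:=p'_u$ and $g_{D,-u}:=\Delta^*_u$. A hyper-node is a set $U\subseteq V_H$ of nodes that induces a connected subgraph before the attack. $E_U$ is the set of links in $E_H$ with exactly one endpoint in $U$. $\tilde D_{U,e}:=\sum_{u\in U}\tilde D_{u,e}$. If $E_U\cap F\ne\emptyset$: $S_U:=\{e\in E_U\setminus F:\exists l\in E_U\cap F,\ \tilde D_{U,l}\tilde D_{U,e}>0\}$, and $f_{U,g}:=\sum_{u\in U}g_{D,u}$ if there is $l\in E_U\cap F$ with $\tilde D_{U,l}<0$, and $f_{U,g}:=\sum_{u\in U}g_{D,-u}$ otherwise. If $E_U\cap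 F=\emptyset$: $f_{U,g}:=\sum_{u\in U}g_{D,u}$ if there is $l\in E_U\setminus F$ with $\tilde D_{U,l}>0$, and $f_{U,g}:=\sum_{u\in U}g_{D,-u}$ otherwise. *)

(* Defs.v *)
From mathcomp Require Import all_boot all_order all_algebra.
Set Implicit Arguments.
Unset Strict Implicit.
Unset Printing Implicit Defensive.
Import Order.TTheory GRing.Theory Num.Theory.
Local Open Scope ring_scope.

(* An undirected link (s,t) is encoded as the two-element set [set s; t], and
   a graph on V as its set E of links. *)

Definition simple_graph (V : finType) (E : {set {set V}}) : Prop :=
  forall e, e \in E -> #|e| = 2%N.

(* The subgraph of (V, E) induced by U is connected. *)
Definition connected_in (V : finType) (E : {set {set V}}) (U : {set V}) : Prop :=
  forall u v, u \in U -> v \in U ->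
    connect [rel a b | [&& a \in U, b \in U & [set a; b] \in E]] u v.

Definition induced_links (V : finType) (E : {set {set V}}) (VH : {set V}) :
    {set {set V}} :=
  [set e in E | e \subset VH].

Definition reactance (R : realFieldType) (V : finType) (E : {set {set V}})
    (r : V -> V -> R) : Prop :=
  forall s t, [set s; t] \in E -> r s t = r t s /\ r s t != 0.

Definition adm_off (R : realFieldType) (V : finType) (E : {set {set V}})
    (r : V -> V -> R) (u v : V) : R :=
  if [set u; v] \in E then - (1 / r u v) else 0.

Definition admittance (R : realFieldType) (V : finType) (E : {set {set V}})
    (r : V -> V -> R) (u v : V) : R :=
  if u == v then - \sum_(w | w != u) adm_off E r u w else adm_off E r u v.

(* Product of a V-by-V matrix with a vector indexed by V. *)
Definition mulmxv (R : realFieldType) (V : finType) (B : V -> V -> R)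
    (x : V -> R) (u : V) : R :=
  \sum_v B u v * x v.

(* d is a change of injection allowed at a node with injection pv. *)
Definition admissible_change (R : realFieldType) (pv d : R) : Prop :=
  if 0 < pv then 0 <= d <= pv else pv <= d <= 0.

(* The matrix D~.  For a link e containing u, the v found by [pick] is the
   other endpoint of e, and it is unique. *)
Definition Dt (R : realFieldType) (V : finType) (r : V -> V -> R)
    (theta' : V -> R) (u : V) (e : {set V}) : R :=
  if [pick v | e == [set u; v]] is Some v
  then (theta' u - theta' v) / r u v else 0.

(* The linear program.  Vectors indexed by V_H or E_H are total functions whose
   values outside V_H, E_H are never used. *)
Definition fld_feasible (R : realFieldType) (V : finType) (E : {set {set V}})
    (VH : {set V}) (r : V -> V -> R) (theta theta' p : V -> R)
    (x : {set V} -> R) (delta : V -> R) : Prop :=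
  let EH := induced_links E VH in
  [/\ forall v, v \in VH ->
        delta v = mulmxv (admittance E r) (fun w => theta w - theta' w) v
                  + \sum_(e in EH) Dt r theta' v e * x e,
      forall v, v \in VH -> admissible_change (p v) (delta v)
    & forall e, e \in EH -> 0 <= x e <= 1].

Definition fld_optimal (R : realFieldType) (V : finType) (E : {set {set V}})
    (VH : {set V}) (r : V -> V -> R) (theta theta' p : V -> R)
    (x : {set V} -> R) (delta : V -> R) : Prop :=
  let EH := induced_links E VH in
  fld_feasible E VH r theta theta' p x delta /\
  forall y eps, fld_feasible E VH r theta theta' p y eps ->
    \sum_(e in EH) x e <= \sum_(e in EH) y e.

(* The set F^ returned from the LP solution x. *)
Definition detected (R : realFieldType) (V : finType) (E : {set {set V}})
    (VH : {set V}) (eta : R) (x : {set V} -> R) : {set {set V}} :=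
  [set e in induced_links E VH | eta <= x e].

(* g_{D,u} and g_{D,-u}, with p u - p' u for Delta^*_u. *)
Definition gD (R : realFieldType) (V : finType) (p p' : V -> R) (u : V) : R :=
  if p u <= 0 then - (p u - p' u) else p' u.

Definition gDneg (R : realFieldType) (V : finType) (p p' : V -> R) (u : V) : R :=
  if p u <= 0 then - p' u else p u - p' u.

Definition hyper_node (V : finType) (E : {set {set V}}) (VH U : {set V}) : Prop :=
  U \subset VH /\ connected_in E U.

(* E_U *)
Definition boundary (V : finType) (E : {set {set V}}) (VH U : {set V}) :
    {set {set V}} :=
  [set e in induced_links E VH | #|e :&: U| == 1%N].

Definition DtU (R : realFieldType) (V : finType) (r : V -> V -> R)
    (theta' : V -> R) (U : {set V}) (e : {set V}) : R :=
  \sum_(u in U) Dt r theta' u e.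

(* S_U *)
Definition SU (R : realFieldType) (V : finType) (E : {set {set V}})
    (VH : {set V}) (r : V -> V -> R) (theta' : V -> R) (F : {set {set V}})
    (U : {set V}) : {set {set V}} :=
  let EU := boundary E VH U in
  [set e in EU :\: F |
    [exists l in EU :&: F, 0 < DtU r theta' U l * DtU r theta' U e]].

(* f_{U,g} *)
Definition fUg (R : realFieldType) (V : finType) (E : {set {set V}})
    (VH : {set V}) (r : V -> V -> R) (theta' p p' : V -> R)
    (F : {set {set V}}) (U : {set V}) : R :=
  let EU := boundary E VH U in
  let gpos := \sum_(u in U) gD p p' u in
  let gneg := \sum_(u in U) gDneg p p' u in
  if EU :&: F != set0 then
    if [exists l in EU :&: F, DtU r theta' U l < 0] then gpos else gneg
  else
    if [exists l in EU :\: F, 0 < DtU r theta' U l] then gpos else gneg.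

(* Main.v *)
Require Import Defs.
From mathcomp Require Import all_boot all_order all_algebra.
From mathcomp Require Import ring lra.
Import Order.TTheory GRing.Theory Num.Theory.
Local Open Scope ring_scope.
Set Implicit Arguments.
Unset Strict Implicit.

(** Since [B theta = p] and [B' theta' = p'], the equality constraints of the
    linear program say [delta - Delta* = D~ (x - 1_F)] on [V_H].  Summing over
    the hyper-node [U] cancels the links inside [U], leaving
    [\sum_(u in U) (delta u - Delta* u) = \sum_(e in E_U) D~_(U,e) (x e - 1_F e)].
    Hypotheses 1 and 2 give every term on the right the sign of [D~_(U,l)], so
    if [x l >= eta] the right-hand side is at least [eta |D~_(U,l)|] in
    absolute value; the bounds on [delta] limit the left-hand side to
    [f_(U,g)] in that direction. *)

Lemma set2_injr (T : finType) (u v w : T) : [set u; v] = [set u; w] -> v = w.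
Proof.
move=> e.
have := set22 u v; rewrite e !inE => /orP[/eqP vu|/eqP //].
by have := set22 u w; rewrite -e vu !inE orbb => /eqP.
Qed.

Section Flow.
Variables (R : realFieldType) (V : finType) (r : V -> V -> R) (t : V -> R).

Lemma Dt_set2 (u v : V) : Dt r t u [set u; v] = (t u - t v) / r u v.
Proof.
rewrite /Dt; case: pickP => [w /eqP /set2_injr -> //|/(_ v)].
by rewrite eqxx.
Qed.

Lemma Dt_notin (u : V) (e : {set V}) : u \notin e -> Dt r t u e = 0.
Proof.
by rewrite /Dt; case: pickP => // w /eqP ->; rewrite set21.
Qed.

(** At most one [v] satisfies the condition, by [set2_injr]. Written as a sum, [Dt] can be matched
    with a sum over neighbours grouped by link. *)
Lemma Dt_sum (u : V) (e : {set V}) :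
  Dt r t u e = \sum_(v | [set u; v] == e) (t u - t v) / r u v.
Proof.
rewrite /Dt; case: pickP => [w /eqP ->|e0].
  rewrite (big_pred1 w) // => v /=.
  by apply/eqP/eqP => [/set2_injr|->].
by rewrite big_pred0 // => v; rewrite eq_sym.
Qed.

(** The diagonal entry is minus the sum of the rest of its row, so row [u] of the product is the net
    flow out of [u], the sum of [(t u - t v) / r u v] over its neighbours. *)
Lemma mulmxv_admittance (E : {set {set V}}) (u : V) :
  mulmxv (admittance E r) t u = \sum_(e in E) Dt r t u e.
Proof.
transitivity (\sum_(v | [set u; v] \in E) (t u - t v) / r u v); last first.
  rewrite (partition_big (fun v => [set u; v]) (mem E)) //=.
  apply: eq_bigr => e eE; rewrite Dt_sum; apply: eq_bigl => v.
  by case: eqP => [->|]; rewrite ?andbF ?andbT // eE.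
rewrite /mulmxv (bigD1 u) //= {1}/admittance eqxx mulNr mulr_suml -sumrN.
(* The term [v = u] vanishes whether or not [[set u; u]] lies in [E]. *)
rewrite -big_split /= [RHS]big_mkcond /= [RHS](bigD1 u) //= subrr mul0r.
rewrite if_same add0r; apply: eq_bigr => v vu.
rewrite /admittance eq_sym (negbTE vu) /adm_off.
by case: ifP => _; ring.
Qed.

Lemma DtU_set2 (U : {set V}) (a b : V) : a != b ->
  DtU r t U [set a; b] =
    (if a \in U then (t a - t b) / r a b else 0)
    + (if b \in U then (t b - t a) / r b a else 0).
Proof.
move=> ab; rewrite /DtU big_mkcond (bigD1 a) //= (bigD1 b) 1?eq_sym //=.
rewrite Dt_set2 [in Dt _ _ b _]setUC Dt_set2 big1 ?addr0 // => u /andP[ua ub].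
by rewrite Dt_notin ?if_same // !inE negb_or ua.
Qed.

Lemma card_set2I (U : {set V}) (a b : V) : a != b ->
  #|[set a; b] :&: U| = ((a \in U) + (b \in U))%N.
Proof.
move=> ab; rewrite -sum1_card big_mkcond (bigD1 a) //= (bigD1 b) 1?eq_sym //=.
rewrite big1 => [|u /andP[ua ub]]; last by rewrite !inE (negbTE ua) (negbTE ub).
by rewrite !inE !eqxx orbT /=; case: (a \in U); case: (b \in U).
Qed.

Variables (E : {set {set V}}) (VH : {set V}).
Hypotheses (hE : simple_graph E) (hr : reactance E r).

(** Such a link has both ends in [U], and its two flows cancel because [r] is symmetric on links, or
    no end in [U]. *)
Lemma DtU_eq0 (U e : {set V}) :
  e \in induced_links E VH -> e \notin boundary E VH U -> DtU r t U e = 0.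
Proof.
move=> eH; rewrite inE eH /=; move: eH; rewrite inE => /andP[eE _].
have /eqP/cards2P[a [b [ab eab]]] := hE eE; rewrite eab in eE *.
rewrite card_set2I // DtU_set2 // -(hr eE).1.
by case: (a \in U); case: (b \in U) => //= _; ring.
Qed.

(** Only the end of [e] inside [U] contributes, and the angles at the two ends differ. *)
Lemma DtU_neq0 (U e : {set V}) :
  (forall u v, [set u; v] \in induced_links E VH -> t u != t v) ->
  e \in boundary E VH U -> DtU r t U e != 0.
Proof.
move=> ht; rewrite inE => /andP[eH]; have := eH; rewrite inE => /andP[eE _].
have /eqP/cards2P[a [b [ab eab]]] := hE eE; rewrite eab in eE eH *.
have tab := ht _ _ eH; have [rC r0] := hr eE.
rewrite card_set2I // DtU_set2 // -rC.
case: (a \in U); case: (b \in U) => //= _; rewrite ?addr0 ?add0r mulf_neq0 //;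
  by rewrite ?invr_neq0 // subr_eq0 // eq_sym.
Qed.

Lemma sum_DtU_boundary (U : {set V}) (c : {set V} -> R) :
  \sum_(u in U) \sum_(e in induced_links E VH) Dt r t u e * c e =
  \sum_(e in boundary E VH U) DtU r t U e * c e.
Proof.
rewrite exchange_big /= [LHS]big_mkcond [RHS]big_mkcond; apply: eq_bigr => e _.
rewrite -mulr_suml -/(DtU r t U e); case: ifPn => eH; last first.
  by rewrite inE (negbTE eH).
by case: ifPn => // eU; rewrite DtU_eq0 ?mul0r.
Qed.

End Flow.

(** [gD] is the distance from Delta* to the upper end of the admissible interval; [gDneg] is the
    distance to its lower end. *)
Lemma admissible_change_le_gD (R : realFieldType) (V : finType)
    (p p' : V -> R) (u : V) (d : R) :
  admissible_change (p u) d -> d - (p u - p' u) <= gD p p' u.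
Proof. by rewrite /admissible_change /gD; case: ltP => _ /andP[]; lra. Qed.

Lemma admissible_change_ge_gDneg (R : realFieldType) (V : finType)
    (p p' : V -> R) (u : V) (d : R) :
  admissible_change (p u) d -> - gDneg p p' u <= d - (p u - p' u).
Proof. by rewrite /admissible_change /gDneg; case: ltP => _ /andP[]; lra. Qed.

(** Applied to [theta'], the two admittance matrices differ exactly by the flows on [F]. Hence
    Delta* and the indicator of [F] solve the equality constraints, and [x] is measured against
    them. *)
Lemma constraint_defect (R : realFieldType) (V : finType)
    (E : {set {set V}}) (r : V -> V -> R) (VH : {set V}) (F : {set {set V}})
    (theta p theta' p' : V -> R) (x : {set V} -> R) (u : V) :
  F \subset induced_links E VH ->
  mulmxv (admittance E r) theta u = p u ->
  mulmxv (admittance (E :\: F) r) theta' u = p' u ->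
  mulmxv (admittance E r) (fun w => theta w - theta' w) u
    + \sum_(e in induced_links E VH) Dt r theta' u e * x e =
  p u - p' u
    + \sum_(e in induced_links E VH) Dt r theta' u e * (x e - (e \in F)%:R).
Proof.
move=> FH <- <-.
have -> : mulmxv (admittance E r) (fun w => theta w - theta' w) u =
    mulmxv (admittance E r) theta u - mulmxv (admittance E r) theta' u.
  by rewrite /mulmxv -sumrB; apply: eq_bigr => v _; rewrite mulrBr.
have FE : F \subset E.
  by apply: (subset_trans FH); apply/subsetP => e; rewrite inE => /andP[].
have -> : \sum_(e in induced_links E VH)
      Dt r theta' u e * (x e - (e \in F)%:R) =
    \sum_(e in induced_links E VH) Dt r theta' u e * x e
    - \sum_(e in F) Dt r theta' u e.
  under eq_bigr do rewrite mulrBr.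
  rewrite sumrB; congr (_ - _).
  rewrite [LHS]big_mkcond [RHS]big_mkcond; apply: eq_bigr => e _.
  have := subsetP FH e; case: (e \in F) => [->//|_]; first by rewrite mulr1.
  by rewrite mulr0 if_same.
rewrite !(mulmxv_admittance r theta') (big_setID F) /= (setIidPr FE).
by ring.
Qed.

Unset Implicit Arguments.
Set Strict Implicit.

Theorem theoremV2 (R : realFieldType) (V : finType)
    (E : {set {set V}}) (r : V -> V -> R)
    (VH : {set V}) (F : {set {set V}})
    (theta p theta' p' : V -> R) (eta : R)
    (hE : simple_graph E)
    (hconn : connected_in E [set: V])
    (hr : reactance E r)
    (hF0 : F != set0)
    (hF : F \subset induced_links E VH)
    (hp : forall v, mulmxv (admittance E r) theta v = p v)
    (hp' : forall v, mulmxv (admittance (E :\: F) r) theta' v = p' v)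
    (htheta' : forall s t, [set s; t] \in induced_links E VH ->
       theta' s != theta' t)
    (hDelta : forall v, v \in VH -> admissible_change (p v) (p v - p' v))
    (heta : 0 < eta < 1)
    (l : {set V}) (hl : l \in induced_links E VH :\: F)
    (hU : exists U : {set V},
       [/\ hyper_node E VH U /\ l \in boundary E VH U,
           forall e e',
             e \in boundary E VH U :&: (induced_links E VH :\: F) ->
             e' \in boundary E VH U :&: (induced_links E VH :\: F) ->
             0 < DtU r theta' U e * DtU r theta' U e',
           boundary E VH U :&: F != set0 -> SU E VH r theta' F U = set0
         & fUg E VH r theta' p p' F U - eta * `|DtU r theta' U l| < 0])
    (x : {set V} -> R) (delta : V -> R)
    (hopt : fld_optimal E VH r theta theta' p x delta) :
  l \notin detected E VH eta x.
Proof.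
have [[hfeas hadm hx] _] := hopt.
have [U [[[/subsetP UVH _] lU] same S0 fneg]] := hU.
have Dl0 := DtU_neq0 hE hr htheta' lU.
have /setDP[lH lF] := hl.
rewrite inE lH /=; apply/negP => xl.
pose S := \sum_(u in U) (delta u - (p u - p' u)).
have SE : S = \sum_(e in boundary E VH U)
    DtU r theta' U e * (x e - (e \in F)%:R).
  rewrite -sum_DtU_boundary //; apply: eq_bigr => u uU.
  by rewrite hfeas ?UVH // (constraint_defect x hF (hp u) (hp' u)); ring.
have UH e : e \in boundary E VH U -> e \in induced_links E VH.
  by rewrite inE => /andP[].
(* A positive product would put [l] in [SU], which is empty. *)
have sameF e : e \in boundary E VH U -> e \in F ->
    DtU r theta' U e * DtU r theta' U l <= 0.
  move=> eU eF; rewrite leNgt; apply/negP => pos.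
  have eUF : e \in boundary E VH U :&: F by rewrite inE eU.
  have : l \in SU E VH r theta' F U.
    by rewrite inE inE lF lU /=; apply/existsP; exists e; rewrite eUF.
  by rewrite S0 ?inE //; apply/set0Pn; exists e.
have same1 e : e \in boundary E VH U -> e \notin F ->
    0 < DtU r theta' U e * DtU r theta' U l.
  by move=> eU eF; apply: same; rewrite in_setI in_setD UH ?eU ?eF ?lU ?lF.
(* Multiplying by [DtU r theta' U l] treats both signs at once. Every term becomes nonnegative: on
   [F] both factors are nonpositive, as [x e <= 1]; off [F] both are nonnegative. *)
have DlS : eta * DtU r theta' U l ^+ 2 <= DtU r theta' U l * S.
  rewrite SE (bigD1 l) //= (negbTE lF) subr0 mulrDr -[leLHS]addr0.
  apply: lerD.
    by rewrite mulrA -expr2 mulrC ler_wpM2l ?sqr_ge0.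
  rewrite mulr_sumr; apply: sumr_ge0 => e /andP[eU _].
  have /andP[x0 x1] := hx e (UH e eU); rewrite mulrA [X in X * _]mulrC.
  case: (boolP (e \in F)) => eF.
    by rewrite mulr_le0 ?sameF // subr_le0.
  by rewrite subr0 mulr_ge0 // ltW ?same1.
have Spos : S <= \sum_(u in U) gD p p' u.
  by apply: ler_sum => u uU; apply/admissible_change_le_gD/hadm/UVH.
have Sneg : - S <= \sum_(u in U) gDneg p p' u.
  rewrite lerNl -sumrN; apply: ler_sum => u uU.
  exact/admissible_change_ge_gDneg/hadm/UVH.
(* All case distinctions in [fUg] reduce to the sign of the flow on [l]: failed boundary links have
   the opposite sign, strictly by [DtU_neq0], and operational ones the same sign. *)
have fE : fUg E VH r theta' p p' F U =
    if 0 < DtU r theta' U l then \sum_(u in U) gD p p' u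
    else \sum_(u in U) gDneg p p' u.
  rewrite /fUg; case: ifPn => [/set0Pn[f /setIP[fU fF]]|UF0].
    congr (if _ then _ else _); apply/existsP/idP.
      move=> [e /andP[/setIP[eU eF] De]].
      by rewrite lt0r Dl0 -(nmulr_rle0 _ De) sameF.
    move=> Dlp; exists f; rewrite inE fU fF /=.
    rewrite lt_neqAle (DtU_neq0 hE hr htheta' fU) /=.
    by rewrite -(pmulr_lle0 _ Dlp) sameF.
  congr (if _ then _ else _); apply/existsP/idP.
    by move=> [e /andP[/setDP[eU eF] De]]; rewrite -(pmulr_rgt0 _ De) same1.
  by move=> Dlp; exists l; rewrite inE lF lU.
(* Cancelling one factor of the square bounds [S] below by [eta] times the flow on [l] if that flow
   is positive, and above if it is negative; [Spos] or [Sneg] then contradicts [fneg]. *)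
move: fneg; rewrite fE expr2 mulrCA in DlS *.
case: ltrgt0P Dl0 => // Dl _.
  by move: DlS; rewrite ler_pM2l //; lra.
by move: DlS; rewrite ler_nM2l //; lra.
Qed.
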